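(* Let $D$ be a northwest diagram and $r$ a row index such that every cell of $D$ in row $r$ has a cell of $D$ directly below it in row $r+1$. Then for every $T\in\mathrm{KD}(D)$ with $f_r(T)\neq 0$ we have $f_r(T)\in\mathrm{KD}(D)$. In particular $\mathfrak{D}_r(\mathrm{KD}(D))=\mathrm{KD}(D)$.
   Context: A diagram is a finite set of cells $(i,j)\in\mathbb{Z}_{>0}^2$ ($i$ row, $j$ column), rows numbered top to bottom. $D$ is northwest if whenever $(j,k),(i,l)\in D$ with $i<j$, $k<l$, then $(i,k)\in D$. A Kohnert move selects the rightmost cell of some row and moves it up (toward row 1) within its column to the first empty position above it, jumping over occupied positions, if one exists; $\mathrm{KD}(D)$ is the set of diagrams reachable from $D$ by sequences of Kohnert moves (including $D$). Kohnert crystal operators: for a diagram $T$ and $i\ge1$, $i$-pair cells of $T$ in rows $i,i+1$ iteratively by pairing an unpaired cell in row $i+1$ with an unpaired cell in row $i$ weakly to its left whenever all cells in rows $i,i+1$ lying (in columns) between them are already $i$-paired. The raising operator $e_i(T)$ is $0$ if all cells of row $i+1$ are $i$-paired, and otherwise moves the rightmost unpaired cell of row $i+1$ to row $i$ (same column). The lowering operator $f_i(T)$ is $0$ if all cells of row $i$ are $i$-paired, and otherwise moves the leftmost unpaired cell of row $i$ to row $i+1$. For a set $X$ of diagrams, $\mathfrak{D}_i(X)=\{U \text{ a diagram}: e_i^k(U)\in X\text{ for some }k\ge0\}$. *)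

(* Defs.v *)
From mathcomp Require Import all_boot.
From mathcomp Require Import finmap.
From Stdlib Require Import Relation_Operators.

Set Implicit Arguments.
Unset Strict Implicit.
Unset Printing Implicit Defensive.

Local Open Scope fset_scope.

(* A cell is a pair (row, column).  Coordinates are 1-based: the positivity
   of the coordinates is the predicate [is_diagram]. *)
Definition cell : Type := (nat * nat)%type.

Definition is_diagram (D : {fset cell}) : Prop :=
  forall x : cell, x \in D -> 0 < x.1 /\ 0 < x.2.

Definition northwest (D : {fset cell}) : Prop :=
  forall i j k l : nat, i < j -> k < l ->
    (j, k) \in D -> (i, l) \in D -> (i, k) \in D.

Definition move_cell (T : {fset cell}) (x y : cell) : {fset cell} :=
  y |` (T `\ x).

(* The cell (r, c), rightmost in its row, moves up to the nearest empty
   position (s, c) above it; all positions strictly in between are occupied. *)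
Definition kohnert_move (T U : {fset cell}) : Prop :=
  exists r s c : nat,
    [/\ (r, c) \in T /\ (forall c', (r, c') \in T -> c' <= c),
        0 < s < r /\ (s, c) \notin T,
        (forall t, s < t < r -> (t, c) \in T)
      & U = move_cell T (r, c) (s, c)].

Definition KD (D : {fset cell}) : {fset cell} -> Prop :=
  clos_refl_trans {fset cell} kohnert_move D.

(* Columns of the cells of T in row i, in increasing order. *)
Definition row_cols (T : {fset cell}) (i : nat) : seq nat :=
  sort leq [seq x.2 | x <- enum_fset T & x.1 == i].

(* A partial i-pairing is a list M of pairs (a, b), meaning that the cell
   (i, a) is paired with the cell (i+1, b).  "Between" includes the two end
   columns: (i+1, a) and (i, b), if present and a <> b, must be paired too, so
   that two cells in the same column are paired with each other. *)
Definition can_pair (T : {fset cell}) (i : nat) (M : seq (nat * nat))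
    (p : nat * nat) : bool :=
  [&& p.1 <= p.2, p.1 \notin unzip1 M, p.2 \notin unzip2 M,
      all (fun a => (p.1 < a <= p.2) ==> (a \in unzip1 M)) (row_cols T i)
    & all (fun b => (p.1 <= b < p.2) ==> (b \in unzip2 M)) (row_cols T i.+1)].

Definition pairable (T : {fset cell}) (i : nat) (M : seq (nat * nat)) :
    seq (nat * nat) :=
  [seq p <- [seq (a, b) | a <- row_cols T i, b <- row_cols T i.+1]
     | can_pair T i M p].

Definition pair_step (T : {fset cell}) (i : nat) (M : seq (nat * nat)) :
    seq (nat * nat) :=
  if pairable T i M is p :: _ then p :: M else M.

(* Each effective step uses up a cell of row i, so this number of steps
   exhausts the process; see [pairable_pairing]. *)
Definition pairing (T : {fset cell}) (i : nat) : seq (nat * nat) :=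
  iter (size (row_cols T i)) (pair_step T i) [::].

Lemma pairable_pairing (T : {fset cell}) (i : nat) :
  pairable T i (pairing T i) = [::].
Proof.
have inv n : let M := iter n (pair_step T i) [::] in
    [/\ uniq (unzip1 M), {subset unzip1 M <= row_cols T i}
      & pairable T i M = [::] \/ size (unzip1 M) = n].
  elim: n => [|n [U S C]] /=; first by split=> //; right.
  set M := iter n _ _ in U S C *; rewrite /pair_step.
  case E: (pairable T i M) C => [|p s] C; first by split=> //; left.
  have : p \in pairable T i M by rewrite E mem_head.
  rewrite mem_filter => /andP[/and5P[_ np _ _ _]] /allpairsP[[a b]] [/= aT _ pE].
  split; first by rewrite /= np.
    by move=> x; rewrite /= inE pE => /orP[/eqP->//|/S].
  by case: C => // C; right; rewrite /= C.
rewrite /pairing; have [U S [//|C]] := inv (size (row_cols T i)).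
set M := iter _ _ _ in U S C *.
have [_ eqM] := uniq_min_size U S (eq_leq (esym C)).
case E: (pairable T i M) => [//|p s].
have : p \in pairable T i M by rewrite E mem_head.
rewrite mem_filter => /andP[/and5P[_ np _ _ _]] /allpairsP[[a b]] [/= aT _ pE].
by move: np; rewrite eqM pE aT.
Qed.

Definition unpaired_upper (T : {fset cell}) (i : nat) : seq nat :=
  [seq a <- row_cols T i | a \notin unzip1 (pairing T i)].

Definition unpaired_lower (T : {fset cell}) (i : nat) : seq nat :=
  [seq b <- row_cols T i.+1 | b \notin unzip2 (pairing T i)].

(* The value 0 of the crystal operators is rendered by None. *)
Definition raise (i : nat) (T : {fset cell}) : option {fset cell} :=
  omap (fun c => move_cell T (i.+1, c) (i, c)) (ohead (rev (unpaired_lower T i))).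

Definition lower (i : nat) (T : {fset cell}) : option {fset cell} :=
  omap (fun c => move_cell T (i, c) (i.+1, c)) (ohead (unpaired_upper T i)).

(* The k-th iterate of [raise i], with 0 sent to 0. *)
Definition raise_iter (i k : nat) (T : {fset cell}) : option {fset cell} :=
  iter k (obind (raise i)) (Some T).

Definition demazure (i : nat) (X : {fset cell} -> Prop) (U : {fset cell}) :
    Prop :=
  is_diagram U /\ exists k V, raise_iter i k U = Some V /\ X V.

(* Main.v *)
Require Import Defs.
From mathcomp Require Import all_boot.
From mathcomp Require Import finmap.
From mathcomp Require Import zify.
From Stdlib Require Import Relation_Operators.

(* Give every cell the row of D it came from as a label; going from right to left,
   a cell must stay weakly below the cells of the same label on its right, since
   those move first.  For the columns from c on let need(x, y) be the number of
   labels at most y that this forces into rows below x, after rectifying these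
   columns into a single one.  For northwest D, a diagram T with the column sizes
   of D is in KD(D) exactly when in each column c, for z <= y <= max D_c, at least
   as many cells of T as of D lie in rows up to y and at least need(z, y) cells,
   computed from the columns right of c, lie in rows z+1, ..., y.

   Necessity: need can only decrease under a Kohnert move.  Sufficiency: if row rho
   of T is occupied but not by a cell labelled rho, take the leftmost cell of that
   row and the first gap e below it; lower the cell to e if row e is empty to the
   right, and otherwise repeat with row e and the columns to the right.  Columns
   avoiding row rho exceed what is needed by one, so they absorb the change.

   Lowering the leftmost unpaired cell of row r can raise need(x, y) only at x = r,
   and only if no cell of row r+1 in these columns is unpaired; so no condition
   breaks in a column further left.  Since row r of D is contained in row r+1, none
   breaks in the column of the cell itself. *)

Set Implicit Arguments.
Unset Strict Implicit.
Unset Printing Implicit Defensive.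

Implicit Types (t d : nat -> bool) (g : nat -> nat -> nat).

(** * One column *)

Definition N (t : nat -> bool) (x : nat) : nat := count t (iota 1 x).

Lemma N0 t : N t 0 = 0. Proof. by []. Qed.

Lemma NS t x : N t x.+1 = N t x + t x.+1.
Proof. by rewrite /N -[in LHS](addn1 x) iotaD count_cat /= addn0 add1n. Qed.

Lemma eq_N t t' : t =1 t' -> N t =1 N t'.
Proof. by move=> h x; apply: eq_count. Qed.

Lemma leq_N t x z : x <= z -> N t x <= N t z.
Proof. by move=> /subnKC<-; elim: (z - x) => [|k IH]; rewrite ?addn0 // addnS NS; lia. Qed.

Lemma N_lip t x z : x <= z -> N t z <= N t x + (z - x).
Proof.
move=> xz; rewrite -{1}(subnKC xz); elim: (z - x) => [|k IH]; rewrite ?addn0 // addnS NS.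
by case: (t _); lia.
Qed.

Lemma N_full t x z : x <= z -> (forall i, x < i <= z -> t i) -> N t z = N t x + (z - x).
Proof.
elim: z => [|z IH] xz h; first by have -> : x = 0 by lia.
have [e|{}xz] : x = z.+1 \/ x <= z by lia.
  by rewrite -e subnn addn0.
rewrite NS IH // => [|i hi]; last by apply: h; lia.
by rewrite h; lia.
Qed.

Section Columns.

Variable B : nat.

Definition maxrow (d : nat -> bool) : nat := \max_(i < B.+1 | d i) i.

Lemma leq_maxrow d i : i <= B -> d i -> i <= maxrow d.
Proof.
move=> iB di; have h : i < B.+1 by [].
exact: (@leq_bigmax_cond _ (fun j : 'I_B.+1 => d j) (fun j => j : nat) (Ordinal h) di).
Qed.

Lemma maxrow_mem d : 0 < maxrow d -> d (maxrow d).
Proof.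
have [/card0_eq h0|] := posnP #|[pred i : 'I_B.+1 | d i]|.
  by rewrite /maxrow big_pred0 // => i; have := h0 i; rewrite inE.
move=> /(@eq_bigmax_cond _ _ (fun i : 'I_B.+1 => i : nat)) [i di e] _.
by rewrite /maxrow e; move: di; rewrite inE.
Qed.

Lemma maxrow_leq d : maxrow d <= B.
Proof. by apply/bigmax_leqP => i _; rewrite -ltnS ltn_ord. Qed.

Lemma N_maxrow d x : maxrow d <= x <= B -> N d x = N d B.
Proof.
move=> /andP[mx xB]; rewrite -(subnKC xB).
have : x + (B - x) <= B by lia.
elim: (B - x) => [|k IH] h; rewrite ?addn0 // addnS NS -IH; last by lia.
case E: (d (x + k).+1) => //; last by lia.
have := leq_maxrow _ E; lia.
Qed.

(* The recursion computing the bound need(x, y) for the columns from t (with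
   labels d) on, from the bound g for the columns to its right.  If
   y is at most the last label of t, the labels up to y of the later columns are
   labels of t, and at least N d y - N t x of its cells with label at most y lie
   below row x.  Otherwise all of t counts, and so do the later cells that no cell
   of t below them can stand for. *)
Definition gstep (t d : nat -> bool) (g : nat -> nat -> nat) (x y : nat) : nat :=
  if y <= maxrow d then
    maxn (N d y - N t x) (\max_(z < x.+1) (g z y - (N t x - N t z)))
  else \max_(z < B.+1 | x <= z) (g z y + (N t z - N t x)).

Definition bounded (t : nat -> bool) := forall x, t x -> 0 < x <= B.

Definition fits (t d : nat -> bool) (g : nat -> nat -> nat) :=
  [/\ bounded t, N t B = N d B,
      forall y, y <= maxrow d -> N d y <= N t y
    & forall y z, z <= y <= maxrow d -> g z y + N t z <= N t y].

Definition vanish (g : nat -> nat -> nat) :=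
  forall x y, (B <= x) || (y <= x) -> g x y = 0.

Definition unit_steps (g : nat -> nat -> nat) :=
  forall x y, g x.+1 y <= g x y <= (g x.+1 y).+1.

Lemma N_bounded t x : bounded t -> B <= x -> N t x = N t B.
Proof.
move=> ht /subnKC<-; elim: (x - B) => [|k IH]; rewrite ?addn0 // addnS NS IH.
by case E: (t _); last lia; have := ht _ E; lia.
Qed.

(** * The one-column recursion as a maximum *)

Section OneColumn.

Variables (t d : nat -> bool) (g : nat -> nat -> nat).
Hypotheses (ht : bounded t) (hv : vanish g).
Notation G := (gstep t d g).

(** Adding [N t x] removes the truncated subtractions. For y up to [maxrow d], [G x y + N t x] is
    the maximum of [N t x], [N d y] and the [g z y + N t z] with [z <= x]; for larger y it is the
    maximum of the [g z y + N t z] with [x <= z]. This lemma and the next four are the two halves of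
    that description. *)
Lemma gstep_low_label x y : y <= maxrow d -> N d y <= G x y + N t x.
Proof. by rewrite /gstep => ->; lia. Qed.

Lemma gstep_low_right x y z : y <= maxrow d -> z <= x -> g z y + N t z <= G x y + N t x.
Proof.
rewrite /gstep => -> zx; have h : z < x.+1 by [].
have := @leq_bigmax _ (fun j : 'I_x.+1 => g j y - (N t x - N t j)) (Ordinal h).
have := leq_N t zx; rewrite /=; lia.
Qed.

Lemma gstep_lowP x y : y <= maxrow d ->
  [\/ G x y = 0, G x y + N t x = N d y
    | exists2 z, z <= x & G x y + N t x = g z y + N t z].
Proof.
move=> ym; rewrite /gstep ym.
have [|z /= ->] := @eq_bigmax _ (fun j : 'I_x.+1 => g j y - (N t x - N t j)).
  by rewrite card_ord.
have zx : z <= x by rewrite -ltnS.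
have := leq_N t zx => hN.
case: (leqP (g z y - (N t x - N t z)) (N d y - N t x)) => h.
  by case: (posnP (N d y - N t x)) => h'; [apply: Or31 | apply: Or32]; lia.
by apply: Or33; exists (z : nat); lia.
Qed.

Lemma gstep_high x y z : maxrow d < y -> x <= z -> g z y + N t z <= G x y + N t x.
Proof.
rewrite ltnNge /gstep => /negbTE -> xz.
case: (leqP z B) => zB.
  have h : z < B.+1 by [].
  have := @leq_bigmax_cond _ (fun j : 'I_B.+1 => x <= j)
    (fun j : 'I_B.+1 => g j y + (N t j - N t x)) (Ordinal h) xz.
  have := leq_N t xz; rewrite /=; lia.
(* Past row B the bound g vanishes and [N t] is constant, so [z = B] ([ord_max]) stands for every
   larger z. *)
rewrite hv ?(ltnW zB) // (N_bounded ht (ltnW zB)).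
case: (leqP x B) => xB; last by rewrite (N_bounded ht (ltnW xB)); lia.
have := @leq_bigmax_cond _ (fun j : 'I_B.+1 => x <= j)
  (fun j : 'I_B.+1 => g j y + (N t j - N t x)) ord_max xB.
have := leq_N t xB; rewrite /=; lia.
Qed.

Lemma gstep_highP x y : maxrow d < y ->
  exists2 z, x <= z & G x y + N t x = g z y + N t z.
Proof.
rewrite ltnNge /gstep => /negbTE ->.
case: (leqP x B) => xB; last first.
  exists x => //; rewrite hv ?(ltnW xB) // big_pred0 // => z.
  by apply/negbTE; rewrite -ltnNge (leq_trans _ xB).
have [|z xz ->] := @eq_bigmax_cond _ (fun j : 'I_B.+1 => x <= j)
    (fun j : 'I_B.+1 => g j y + (N t j - N t x)).
  by apply/card_gt0P; exists ord_max.
by exists (z : nat) => //; have := leq_N t xz; lia.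
Qed.

End OneColumn.

Lemma gstep_le t d g g' : bounded t -> vanish g -> vanish g' ->
  (forall x y, g' x y <= g x y) -> forall x y, gstep t d g' x y <= gstep t d g x y.
Proof.
move=> ht hv hv' hg x y; case: (leqP y (maxrow d)) => ym.
  have [||[z zx]] := gstep_lowP t g' x ym; first by move->.
    by have := gstep_low_label t g x ym; lia.
  by have := gstep_low_right t g ym zx; have := hg z y; lia.
have [z xz] := gstep_highP t hv' x ym.
by have := gstep_high ht hv ym xz; have := hg z y; lia.
Qed.

Lemma fits_le t d g g' : (forall x y, g' x y <= g x y) -> fits t d g -> fits t d g'.
Proof.
move=> hg [h1 h2 h3 h4]; split=> // y z zy.
by have := h4 _ _ zy; have := hg z y; lia.
Qed.

Lemma fits_top t d g x : fits t d g -> maxrow d <= x <= B -> N t x = N d B.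
Proof.
move=> [h1 h2 h3 h4] /andP[mx xB].
have := h3 _ (leqnn _); rewrite N_maxrow ?leqnn ?maxrow_leq // -h2.
by have := leq_N t mx; have := leq_N t xB; lia.
Qed.

Lemma gstep_vanish t d g : fits t d g -> vanish g -> vanish (gstep t d g).
Proof.
move=> ft hv x y; have [ht h2 h3 h4] := ft.
have mB := maxrow_leq d.
case: (leqP y (maxrow d)) => ym h.
  have yx : y <= x by lia.
  have hN := leq_N t yx.
  have [||[z zx]] := gstep_lowP t g x ym; first by [].
    by have := h3 _ ym; lia.
  case: (leqP z y) => zy; first by have := h4 y z; rewrite zy ym; lia.
  rewrite hv ?(ltnW zy) ?orbT //; have := leq_N t zx; lia.
have [z xz] := gstep_highP t hv x ym.
rewrite hv; last by lia.
have mx : maxrow d <= x by lia.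
case: (leqP B x) => Bx.
  by rewrite !(N_bounded ht) //; lia.
rewrite (fits_top ft); last by lia.
case: (leqP z B) => zB; first by rewrite (fits_top ft); lia.
by rewrite (N_bounded ht (ltnW zB)) h2; lia.
Qed.

Lemma gstep_unit t d g : bounded t -> vanish g -> unit_steps g -> unit_steps (gstep t d g).
Proof.
move=> ht hv hu x y; apply/andP; split; case: (leqP y (maxrow d)) => ym.
- have [||[z zx]] := gstep_lowP t g x.+1 ym; first by move->.
    by have := gstep_low_label t g x ym; rewrite NS; lia.
  have [e|zx'] : z = x.+1 \/ z <= x by lia.
    by subst z; have := gstep_low_right t g ym (leqnn x); have := hu x y; lia.
  by have := gstep_low_right t g ym zx'; rewrite NS; lia.
- have [z xz] := gstep_highP t hv x.+1 ym.
  have := gstep_high ht hv ym (ltnW xz); rewrite NS; lia.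
- have [||[z zx]] := gstep_lowP t g x ym; first by move->.
    by have := gstep_low_label t g x.+1 ym; rewrite NS; case: (t _); lia.
  by have := gstep_low_right t g ym (leqW zx); rewrite NS; case: (t _); lia.
- have [z xz] := gstep_highP t hv x ym.
  have [e|xz'] : z = x \/ x < z by lia.
    by subst z; have := gstep_high ht hv ym (leqnn x.+1); have := hu x y; lia.
  by have := gstep_high ht hv ym xz'; rewrite NS; case: (t _); lia.
Qed.

(** The Boolean [b] treats at once a label that counts for one and a label absent from all columns.
    In the case [y = maxrow d] the two sides use different branches of [gstep]. *)
Lemma gstep_next_label t d g y (b : bool) : fits t d g -> vanish g ->
    (d y.+1 -> b) -> (forall x, g x y.+1 <= g x y + b) ->
  forall x, gstep t d g x y.+1 <= gstep t d g x y + b.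
Proof.
move=> ft hv hb hg x; have [ht h2 h3 h4] := ft.
have {}hb : d y.+1 <= b by case: (d _) hb => //= /(_ isT) ->.
have [ym|[ym|ym]] : y < maxrow d \/ maxrow d < y \/ maxrow d = y by lia.
- have [||[z zx]] := gstep_lowP t g x ym; first by move->.
    by have := gstep_low_label t g x (ltnW ym); rewrite NS; lia.
  by have := gstep_low_right t g (ltnW ym) zx; have := hg z; lia.
- have [z xz] := gstep_highP t hv x (ltnW ym : maxrow d < y.+1).
  by have := gstep_high ht hv ym xz; have := hg z; lia.
- have yB : y <= B by rewrite -ym maxrow_leq.
  have ymax : maxrow d < y.+1 by lia.
  have ymin : y <= maxrow d by lia.
  have Ny u : y <= u -> N t u = N d y.
    move=> yu; rewrite (N_maxrow (x := y)) ?ym ?leqnn //.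
    case: (leqP u B) => uB; first by apply: (fits_top ft); rewrite ym yu.
    by rewrite (N_bounded ht (ltnW uB)).
  have [z xz] := gstep_highP t hv x ymax.
  have := gstep_low_label t g x ymin; have := hg z.
  have [zy|yz] := leqP z y.
    by have := h4 y z; rewrite zy ymin (Ny y) //; lia.
  have g0 : g z y = 0 by rewrite hv // (ltnW yz) orbT.
  by have := Ny z (ltnW yz); lia.
Qed.

Lemma gstep_gap t d g p y : bounded t -> vanish g -> ~~ t p.+1 ->
  g p y <= g p.+1 y -> gstep t d g p y <= gstep t d g p.+1 y.
Proof.
move=> ht hv tp hg.
have Np : N t p.+1 = N t p by rewrite NS (negbTE tp) addn0.
case: (leqP y (maxrow d)) => ym.
  have [||[z zx]] := gstep_lowP t g p ym; first by move->.
    by have := gstep_low_label t g p.+1 ym; lia.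
  by have := gstep_low_right t g ym (leqW zx); lia.
have [z xz] := gstep_highP t hv p ym.
have [e|xz'] : z = p \/ p < z by lia.
  by subst z; have := gstep_high ht hv ym (leqnn p.+1); lia.
by have := gstep_high ht hv ym xz'; lia.
Qed.

(** * Moving one cell within a column *)

Definition mvcell t (s e : nat) : nat -> bool := fun i => (i == e) || t i && (i != s).

Lemma N_mvcell t s e x : 0 < s -> 0 < e -> t s -> ~~ t e ->
  N (mvcell t s e) x + (s <= x) = N t x + (e <= x).
Proof.
rewrite /mvcell => s0 e0 ts te; elim: x => [|x IH]; first by rewrite !N0; lia.
rewrite !NS; have [xe|xe] := eqVneq x.+1 e; have [xs|xs] := eqVneq x.+1 s.
- by rewrite -xe xs ts in te.
- by rewrite xe (negbTE te) /=; lia.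
- by rewrite xs ts /=; lia.
- by rewrite andbT /=; lia.
Qed.

Lemma bounded_mvcell t s e : bounded t -> 0 < e <= B -> bounded (mvcell t s e).
Proof. by move=> ht he x /orP[/eqP->|/andP[/ht]]. Qed.

Lemma unit_steps_le g x z y : unit_steps g -> x <= z -> g z y <= g x y <= g z y + (z - x).
Proof.
move=> hu xz; rewrite -(subnKC xz); elim: (z - x) => [|k IH]; first by rewrite !addn0; lia.
by rewrite addnS; have := hu (x + k) y; lia.
Qed.

(* Row p is empty in all columns to the right, so g does not drop at p. *)
Lemma mvcell_up t d g p q : fits t d g -> vanish g -> unit_steps g ->
    0 < q < p -> t p -> ~~ t q -> (forall i, q < i < p -> t i) ->
    (forall y, g p.-1 y <= g p y) ->
  fits (mvcell t p q) d g /\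
  forall x y, gstep (mvcell t p q) d g x y <= gstep t d g x y.
Proof.
move=> ft hv hu /andP[q0 qp] tp tq tqp hp; have [ht h2 h3 h4] := ft.
have pB := ht _ tp.
have Nm x : N (mvcell t p q) x + (p <= x) = N t x + (q <= x) by apply: N_mvcell; lia.
have Np z : q <= z < p -> N t p = N t z + (p - z).
  move=> hz; apply: N_full => [|i hi]; first by lia.
  have [->//|ip] := eqVneq i p; apply: tqp; lia.
(* From z to p the bound g falls by at most [p.-1 - z] while [N t] gains [p - z]. Comparison with
   row p thus pays for the extra cell counted at z after the move. *)
have gp z y : q <= z < p -> g z y <= g p y + (p.-1 - z).
  move=> hz; have /andP[_] := @unit_steps_le g z p.-1 y hu ltac:(lia).
  by have := hp y; lia.
have ht' : bounded (mvcell t p q) by apply: bounded_mvcell => //; lia.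
split.
  split=> // [|y ym|y z zy].
  - by have := Nm B; lia.
  - by have := Nm y; have := h3 _ ym; lia.
  have := Nm y; have := Nm z; have := h4 y z zy => h4z.
  have [/andP[qz zp]|out] := boolP (q <= z < p); last by lia.
  have [py|yp] := leqP p y; last by lia.
  have := h4 y p; rewrite py; have := Np z; have := gp z y; rewrite qz zp.
  lia.
move=> x y; case: (leqP y (maxrow d)) => ym.
  have [||[z zx]] := gstep_lowP (mvcell t p q) g x ym; first by move->.
    by have := gstep_low_label t g x ym; have := Nm x; lia.
  have := gstep_low_right t g ym zx; have := Nm x; have := Nm z.
  have [/andP[qz zp]|out] := boolP (q <= z < p); last by lia.
  have [px|xp] := leqP p x; last by lia.
  have := gstep_low_right t g ym px.
  have := Np z; have := gp z y; rewrite qz zp; lia.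
have [z xz] := gstep_highP (mvcell t p q) hv x ym.
have := gstep_high ht hv ym xz; have := Nm x; have := Nm z.
have [/andP[qz zp]|out] := boolP (q <= z < p); last by lia.
have [xp|px] := leqP x p; last by lia.
have := gstep_high ht hv ym xp; have := Np z; have := gp z y; rewrite qz zp; lia.
Qed.

(* Where the requirement g grows, every row from rho down to x was already
   required, so a column avoiding row rho satisfies it with room to spare. *)
Definition slack_growth rho g g' := forall x y,
  g' x y <= g x y \/
  [/\ rho <= x, g' x y <= (g x y).+1
    & forall w, rho <= w.+1 -> w <= x -> g x y + (x - w) <= g w y].

(** Row [w.+1] is the last gap of t up to x. From w to x, [N t] gains only [x - w - 1], whereas
    under [slack_growth] g falls by at least [x - w]: this is the unit of room. *)
Lemma last_gap t rho x : ~~ t rho -> 0 < rho <= x ->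
  exists w, [/\ rho <= w.+1, w < x & N t x = N t w + (x - w.+1)].
Proof.
move=> trho; elim: x => [|x IH] rx; first by lia.
have [tx|tx] := boolP (t x.+1); last first.
  by exists x; rewrite NS (negbTE tx); split; lia.
have rx' : 0 < rho <= x.
  have [e|] := eqVneq rho x.+1; last by lia.
  by rewrite e tx in trho.
have [w [h1 h2 h3]] := IH rx'.
by exists w; rewrite NS tx; split; lia.
Qed.

(** Where g grows at z, the last gap [w.+1] up to z gives a value [g w y + N t w] already larger by
    one. This absorbs the growth for labels up to [maxrow d]. For larger labels the maximum runs
    over rows from x on, so w may be out of range and growth may survive. *)
Lemma slack_column t d g g' rho : fits t d g -> vanish g -> vanish g' -> unit_steps g ->
    0 < rho -> ~~ t rho -> slack_growth rho g g' ->
  [/\ fits t d g',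
      forall x y, y <= maxrow d -> gstep t d g' x y <= gstep t d g x y
    & slack_growth rho (gstep t d g) (gstep t d g')].
Proof.
move=> ft hv hv' hu r0 tr hg; have [ht h2 h3 h4] := ft.
have low x y z : y <= maxrow d -> z <= x ->
    g' z y + N t z <= gstep t d g x y + N t x.
  move=> ym zx; have := gstep_low_right t g ym zx.
  have [|[rz h1 hw]] := hg z y; first by lia.
  have [|w [rw wz Nw]] := @last_gap t rho z tr; first by lia.
  have := hw w rw (ltnW wz).
  by have := gstep_low_right t g ym (leq_trans (ltnW wz) zx); lia.
have lowG x y : y <= maxrow d -> gstep t d g' x y <= gstep t d g x y.
  move=> ym; have [||[z zx]] := gstep_lowP t g' x ym; first by move->.
    by have := gstep_low_label t g x ym; lia.
  by have := low x y z ym zx; lia.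
split=> //.
  split=> // y z /andP[zy ym].
  have [|[rz h1 hw]] := hg z y; first by have := h4 y z; lia.
  have [|w [rw wz Nw]] := @last_gap t rho z tr; first by lia.
  by have := hw w rw (ltnW wz); have := h4 y w; lia.
move=> x y; have [ym|ym] := leqP y (maxrow d); first by left; apply: lowG.
have [z xz Gz] := gstep_highP t hv' x ym.
have Uz := gstep_high ht hv ym xz.
have [le|[rz le hw]] := hg z y; first by left; lia.
have [rx|xr] := leqP rho x; last first.
  left; have xr' : x <= rho.-1 by lia.
  have := gstep_high ht hv ym xr'; have := hw rho.-1.
  have := @N_lip t rho z rz.
  have := NS t rho.-1; rewrite prednK // (negbTE tr); lia.
have [?|Glt] := leqP (gstep t d g' x y) (gstep t d g x y); first by left.
right; split=> //; first by lia.
move=> w rw wx.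
have Gx : gstep t d g x y + N t x = g z y + N t z by lia.
(* Growth at x forces [gstep t d g] to fall at each row from rho to x: at a cell of t because [N t]
   increases, at a gap because g falls by one per row from v to z. *)
have drop v : rho <= v.+1 -> v < x -> (gstep t d g v.+1 y).+1 <= gstep t d g v y.
  move=> rv vx; have [u vu Gu] := gstep_highP t hv v.+1 ym.
  have [tv|tv] := boolP (t v.+1).
    by have := gstep_high ht hv ym (ltnW vu); have := NS t v; rewrite tv; lia.
  have := gstep_high ht hv ym (leqnn v); have := NS t v; rewrite (negbTE tv).
  have := hw v rv ltac:(lia) => gv.
  have [xu|ux] := leqP x u.
    by have := gstep_high ht hv ym xu; have := @N_lip t v.+1 z ltac:(lia); lia.
  have := @unit_steps_le g u z y hu ltac:(lia).
  by have := @N_lip t v.+1 u vu; lia.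
suff chain k v : v + k = x -> rho <= v.+1 -> gstep t d g x y + k <= gstep t d g v y.
  by apply: chain => //; rewrite subnKC.
elim: k v => [|k IH] v e rv; first by rewrite -e !addn0.
by have := drop v rv ltac:(lia); have := IH v.+1 ltac:(lia) ltac:(lia); lia.
Qed.

(** Along a run of cells of t, [gstep] for a label beyond [maxrow d] falls by at least one per row,
    so slack known from row e on extends up to the top of the run. *)
Lemma slack_growth_run t d g g' rho e : bounded t -> vanish g -> vanish g' ->
    rho <= e -> (forall i, rho <= i < e -> t i) ->
    (forall x y, y <= maxrow d -> g' x y <= gstep t d g x y) ->
    slack_growth e (gstep t d g) g' ->
  slack_growth rho (gstep t d g) g'.
Proof.
move=> ht hv hv' re te low hg x y.
have [ym|ym] := leqP y (maxrow d); first by left; apply: low.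
have [|[ex h1 hw]] := hg x y; first by left.
right; split=> //; first by lia.
move=> w rw wx; have [we|ew] := leqP e w.+1; first exact: hw.
have [u eu Gu] := gstep_highP t hv e.-1 ym.
have we : w <= e.-1 by lia.
have Ne : N t e.-1 = N t w + (e.-1 - w) by apply: N_full => // i hi; apply: te; lia.
by have := gstep_high ht hv ym (leq_trans we eu); have := hw e.-1; lia.
Qed.

(** The vanishing of [gstep t d g rho.-1 rho] means that the rows above rho already meet all demands
    for labels up to rho, so the counts up to rows rho, ..., [e.-1] have a cell to spare. The bound
    can grow only at an x in that run, and the cells of the run provide the slack. *)
Lemma settle_column t d g rho e : fits t d g -> vanish g ->
    (forall x y, g x y.+1 <= (g x y).+1) -> t rho -> gstep t d g rho.-1 rho = 0 ->
    ~~ t e -> rho < e -> (forall i, rho < i < e -> t i) ->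
  [/\ e <= maxrow d, fits (mvcell t rho e) d g
    & slack_growth rho (gstep t d g) (gstep (mvcell t rho e) d g)].
Proof.
move=> ft hv hy tr G0 te re tre; have [ht h2 h3 h4] := ft.
have rB := ht _ tr.
have mB := maxrow_leq d.
have rm : rho <= maxrow d.
  have [//|mr] := leqP rho (maxrow d).
  have := @fits_top t d g rho.-1 ft ltac:(lia); have := @fits_top t d g rho ft ltac:(lia).
  by have := NS t rho.-1; rewrite prednK ?tr; lia.
have Nr : N t rho = (N t rho.-1).+1 by have := NS t rho.-1; rewrite prednK ?tr; lia.
have Nrun z : rho <= z < e -> N t z = N t rho + (z - rho).
  by move=> hz; apply: N_full => [|i hi]; [lia | apply: tre; lia].
have Nrun' w z : rho <= w.+1 -> w <= z < e -> N t z = N t w + (z - w).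
  move=> rw wz; apply: N_full => [|i hi]; first by lia.
  by have [->//|?] := eqVneq i rho; apply: tre; lia.
have dN z : rho <= z < e -> N d z < N t z.
  move=> hz; have := gstep_low_label t g rho.-1 rm; have := Nrun z hz.
  by have := @N_lip d rho z ltac:(lia); lia.
have em : e <= maxrow d.
  have [//|me] := leqP e (maxrow d).
  have e1B : e.-1 <= B.
    have [//|Be] := leqP e.-1 B.
    have /ht : t e.-1 by apply: tre; lia.
    by lia.
  by have := dN e.-1 ltac:(lia); have := @N_maxrow d e.-1 ltac:(lia);
     have := @fits_top t d g e.-1 ft ltac:(lia); lia.
have Nm x : N (mvcell t rho e) x + (rho <= x) = N t x + (e <= x) by apply: N_mvcell; lia.
have ht' : bounded (mvcell t rho e) by apply: bounded_mvcell => //; lia.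
have gup x k : g x (rho + k) <= g x rho + k.
  by elim: k => [|k IH]; rewrite ?addn0 // addnS; have := hy x (rho + k); lia.
split=> //.
  split=> // [|y ym|y z zy].
  - by have := Nm B; lia.
  - have := Nm y; have := h3 y ym.
    by have [/dN|] := boolP (rho <= y < e); lia.
  have := Nm y; have := Nm z; have := h4 y z zy.
  have [ry|] := boolP (rho <= y < e); last by lia.
  have [zr|] := ltnP z rho; last by lia.
  have zr' : z <= rho.-1 by lia.
  have := gstep_low_right t g rm zr'; have := Nrun y ry; have := gup z (y - rho).
  by rewrite subnKC; lia.
move=> x y; have [ym|ym] := leqP y (maxrow d).
  have [|Glt] := leqP (gstep (mvcell t rho e) d g x y) (gstep t d g x y); first by left.
  have [G'0|G'd|[z zx G'z]] := gstep_lowP (mvcell t rho e) g x ym; first by lia.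
    have := gstep_low_label t g x ym; have := Nm x => Nx Gd.
    right; split=> [||w rw wx]; [lia | lia |].
    by have := gstep_low_label t g w ym; have := Nrun' w x rw; lia.
  have := gstep_low_right t g ym zx; have := Nm x; have := Nm z => Nz Nx Gz.
  right; split=> [||w rw wx]; [lia | lia |].
  have zw : z <= w by lia.
  by have := gstep_low_right t g ym zw; have := Nrun' w x rw; lia.
have [|Glt] := leqP (gstep (mvcell t rho e) d g x y) (gstep t d g x y); first by left.
have [z xz G'z] := gstep_highP (mvcell t rho e) hv x ym.
have := gstep_high ht hv ym xz; have := Nm x; have := Nm z => Nz Nx Gz.
right; split=> [||w rw wx]; [lia | lia |].
by have := gstep_high ht hv ym (leq_trans wx xz); have := Nrun' w x rw; lia.
Qed.

(** * Lowering a cell from row r to row [r.+1] *)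

Definition label_growth r g :=
  forall x, x < r -> g x r <= g x r.-1 \/ g x r < g x r.+1.

(** [label_growth] is the trace in the bound of row r of D lying inside row [r.+1]: where label r
    raises it, so does label [r.+1]. If [maxrow d <= r], the inclusion excludes r from d, so
    [maxrow d < r] and only label [r.-1] can fall under the other branch of [gstep]. *)
Lemma gstep_label_growth t d g r : bounded d -> fits t d g -> vanish g -> 0 < r ->
  (d r -> d r.+1) -> label_growth r g -> label_growth r (gstep t d g).
Proof.
move=> hd ft hv r0 dr hg x xr; have [ht h2 h3 h4] := ft.
have mB := maxrow_leq d.
have dNr := NS d r; have := NS d r.-1; rewrite prednK // => dNr1.
have [rm|mr] := ltnP r (maxrow d).
  have rm' : r <= maxrow d by lia.
  have rm'' : r.-1 <= maxrow d by lia.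
  have [G0|Gd|[z zx Gz]] := gstep_lowP t g x rm'; first by lia.
    have := gstep_low_label t g x rm; have := gstep_low_label t g x rm''.
    by case: (d r) dr dNr1 => [/(_ isT) dr|_]; rewrite ?dr in dNr *; lia.
  have := gstep_low_right t g rm zx; have := gstep_low_right t g rm'' zx.
  by have := hg z ltac:(lia); lia.
have ndr : ~~ d r.
  apply/negP => /dr dr1; have /andP[_ rB] := hd _ dr1.
  by have := leq_maxrow rB dr1; lia.
have mr' : maxrow d < r.
  rewrite ltn_neqAle mr andbT; apply/eqP => e.
  by have := @maxrow_mem d ltac:(lia); rewrite e (negbTE ndr).
have mr1 : maxrow d < r.+1 by lia.
have [z xz Gz] := gstep_highP t hv x mr'.
have := gstep_high ht hv mr1 xz.
have top u : r.-1 <= u -> N t u = N d B.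
  move=> ru; have [uB|Bu] := leqP u B; last by rewrite (N_bounded ht (ltnW Bu)).
  by apply: (fits_top ft); lia.
have [rz|zr] := leqP r z.
  left; have gz0 : g z r = 0 by rewrite hv // rz orbT.
  have [m1|m1] := leqP r.-1 (maxrow d).
    have := gstep_low_label t g x m1; have := top z; have := top r.-1.
    have := N_maxrow (d := d) (x := r.-1); have [|] := leqP r.-1 B; last by lia.
    by lia.
  by have := gstep_high ht hv m1 xz; lia.
have := hg z zr; have [m1|m1] := leqP r.-1 (maxrow d).
  have := gstep_low_label t g x m1; have := top r.-1; have := h4 r.-1 z.
  by have := N_maxrow (d := d) (x := r.-1); lia.
by have := gstep_high ht hv m1 xz; lia.
Qed.

(** Growth is confined to [x = r], and to labels for which g falls at row r but not at row [r.+1]. P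
    carries a condition on the columns crossed so far, later [balanced]. *)
Definition jump_growth r (P : Prop) g g' := forall x y,
  g' x y <= g x y \/
  [/\ x = r, g' r y <= (g r y).+1, g r y < g r.-1 y, g r y <= g r.+1 y & P].

(** A cell in row [r.+1] only absorbs the growth by comparison with [r.-1] or [r.+1], and a cell in
    row r only is excluded by P. Growth therefore passes only through a column with both cells
    (small labels) or neither (labels beyond [maxrow d]). *)
Lemma jump_growth_column t d g g' r (P : Prop) : fits t d g -> vanish g -> vanish g' ->
    0 < r -> (P -> t r -> t r.+1) -> jump_growth r P g g' ->
  fits t d g' /\ jump_growth r (P /\ t r = t r.+1) (gstep t d g) (gstep t d g').
Proof.
move=> ft hv hv' r0 hP hg; have [ht h2 h3 h4] := ft.
have Nr1 := NS t r; have := NS t r.-1; rewrite prednK // => Nr.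
split.
  split=> // y z /andP[zy ym].
  have [|[zr l1 l2 l3 p]] := hg z y; first by have := h4 y z; rewrite zy ym; lia.
  subst z; have := h4 y r.-1; have := h4 y r.+1; have := hP p; rewrite ym.
  have [ry|yr] := ltnP r y; last first.
    by have g0 : g' r y = 0 by [rewrite hv' // yr orbT]; have := leq_N t zy; lia.
  by case: (t r) Nr => Nr /=; case: (t r.+1) Nr1 => Nr1 /=; lia.
move=> x y; have [ym|ym] := leqP y (maxrow d).
  have [G'0|G'd|[z zx G'z]] := gstep_lowP t g' x ym; first by lia.
    by left; have := gstep_low_label t g x ym; lia.
  have Uz := gstep_low_right t g ym zx.
  have [|[zr l1 l2 l3 p]] := hg z y; first by left; lia.
  subst z; have Ur := @gstep_low_right t d g x y r.-1 ym.
  have Ux := @gstep_low_right t d g x y r.+1 ym.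
  case tr: (t r) Nr hP => Nr hP; case tr1: (t r.+1) Nr1 hP => Nr1 hP; last first.
  - by left; lia.
  - by left; lia.
  - by have := hP p isT.
  have [e|xr] : x = r \/ r < x by lia.
    subst x; have [?|lt] := leqP (gstep t d g' r y) (gstep t d g r y); first by left.
    right; split=> //; try by [split].
    - by lia.
    - by have := gstep_low_right t g ym (leqnn r.-1); lia.
    - by have := gstep_low_right t g ym (leqnn r.+1); lia.
  by left; lia.
have [z xz G'z] := gstep_highP t hv' x ym.
have Uz := gstep_high ht hv ym xz.
have [|[zr l1 l2 l3 p]] := hg z y; first by left; lia.
subst z; have Ur := @gstep_high t d g ht hv x y r.-1 ym.
have Ux := @gstep_high t d g ht hv x y r.+1 ym.
case tr: (t r) Nr hP => Nr hP; case tr1: (t r.+1) Nr1 hP => Nr1 hP.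
- by left; lia.
- by have := hP p isT.
- have [e|xr] : x = r \/ x < r by lia.
    by left; lia.
  by left; lia.
have [xr|e] : x < r \/ x = r by lia.
  by left; lia.
subst x; have [?|lt] := leqP (gstep t d g' r y) (gstep t d g r y); first by left.
right; split=> //; try by [split].
- by lia.
- by have := gstep_high ht hv ym (leqnn r.-1); lia.
- by have := gstep_high ht hv ym (leqnn r.+1); lia.
Qed.

(** Only the count up to row r shrinks. If label r adds nothing to a demand, the demand was already
    met by rows up to [r.-1]; if it adds one, label [r.+1] adds another, yet t has no cell in row
    [r.+1]. Either way one cell was to spare. *)
Lemma lower_column t d g r : bounded d -> fits t d g -> vanish g -> 0 < r ->
    (d r -> d r.+1) -> label_growth r g -> t r -> ~~ t r.+1 ->
  fits (mvcell t r r.+1) d g /\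
  jump_growth r True (gstep t d g) (gstep (mvcell t r r.+1) d g).
Proof.
move=> hd ft hv r0 dr hg tr tr1; have [ht h2 h3 h4] := ft.
have mB := maxrow_leq d.
have Nr1 := NS t r; have := NS t r.-1; rewrite prednK // => Nr.
have dNr1 := NS d r; have := NS d r.-1; rewrite prednK // => dNr.
rewrite tr in Nr; rewrite (negbTE tr1) addn0 in Nr1.
have rB := ht _ tr.
have rm : r < maxrow d.
  have [//|mr] := ltnP r (maxrow d).
  have ndr : d r = false.
    apply/negP => /dr dr1; have /andP[_ r1B] := hd _ dr1.
    by have := leq_maxrow r1B dr1; lia.
  have [rm|mr'] : maxrow d <= r.-1 \/ maxrow d = r by lia.
    by have := @fits_top t d g r ft ltac:(lia); have := @fits_top t d g r.-1 ft ltac:(lia); lia.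
  have := h3 r.-1 ltac:(lia); have := @fits_top t d g r ft ltac:(lia).
  by have := @N_maxrow d r ltac:(lia); lia.
have Nm x : N (mvcell t r r.+1) x + (r <= x) = N t x + (r < x) by apply: N_mvcell; lia.
have ht' : bounded (mvcell t r r.+1) by apply: bounded_mvcell => //; lia.
split.
  split=> // [|y ym|y z zy].
  - by have := Nm B; lia.
  - have := Nm y; have := h3 y ym; have [->|yr] := eqVneq y r; last by lia.
    have := h3 r.-1 ltac:(lia); have := h3 r.+1 ltac:(lia).
    by case: (d r) dr dNr => [/(_ isT) dr|_] dNr; rewrite ?dr in dNr1; lia.
  have := Nm y; have := Nm z; have := h4 y z zy.
  have [yr|yr] := eqVneq y r; last by lia.
  have [zr|zr] := ltnP z r; last by lia.
  subst y; have := hg z zr; have := h4 r.-1 z ltac:(lia); have := h4 r.+1 z ltac:(lia).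
  by lia.
move=> x y; have [ym|ym] := leqP y (maxrow d).
  have [|lt] := leqP (gstep (mvcell t r r.+1) d g x y) (gstep t d g x y); first by left.
  have low w := gstep_low_label t g w ym.
  have rgt w z := @gstep_low_right t d g w y z ym.
  have [G'0|G'd|[z zx G'z]] := gstep_lowP (mvcell t r r.+1) g x ym; first by lia.
    have := Nm x; have := low x => Lx Nx; have xr : x = r by lia.
    subst x; right; split=> //; first by lia.
    + by have := low r.-1; lia.
    + by have := low r.+1; lia.
  have := Nm x; have := Nm z; have := rgt x z zx => Lx Nz Nx.
  have xr : x = r by lia.
  subst x; have zr : z <= r.-1 by lia.
  right; split=> //; first by lia.
  + by have := rgt r.-1 z zr; lia.
  + by have := rgt r.+1 z ltac:(lia); lia.
have [|lt] := leqP (gstep (mvcell t r r.+1) d g x y) (gstep t d g x y); first by left.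
have [z xz G'z] := gstep_highP (mvcell t r r.+1) hv x ym.
have rgt w := @gstep_high t d g ht hv w y z ym.
have := Nm x; have := Nm z; have := rgt x xz => Lx Nz Nx.
have xr : x = r by lia.
subst x; have rz : r < z by lia.
right; split=> //; first by lia.
+ by have := rgt r.-1 ltac:(lia); lia.
+ by have := rgt r.+1 rz; lia.
Qed.

End Columns.

(** * Induction on the columns *)

Section Diagrams.

Variables (B : nat) (D : nat -> nat -> bool).
Implicit Types T U : nat -> nat -> bool.

Hypothesis hD : forall c, bounded B (D c).
Hypothesis nwD : forall c c' i, c < c' -> D c' i -> i <= maxrow B (D c) -> D c i.

Fixpoint need T (n c : nat) : nat -> nat -> nat :=
  if n is n'.+1 then gstep B (T c) (D c) (need T n' c.+1) else fun _ _ => 0.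

Fixpoint fit T (n c : nat) : Prop :=
  if n is n'.+1 then fit T n' c.+1 /\ fits B (T c) (D c) (need T n' c.+1) else True.

Lemma eq_gstep t t' d g g' : t =1 t' -> g =2 g' -> gstep B t d g =2 gstep B t' d g'.
Proof.
move=> ht hg x y; rewrite /gstep !(eq_N ht); case: ifP => _.
  by congr maxn; apply: eq_bigr => z _; rewrite hg !(eq_N ht).
by apply: eq_bigr => z _; rewrite hg !(eq_N ht).
Qed.

Lemma eq_fits t t' d g g' : t =1 t' -> g =2 g' -> fits B t d g -> fits B t' d g'.
Proof.
move=> ht hg [h1 h2 h3 h4]; split=> [x|||y z zy]; rewrite -?ht -?hg -?(eq_N ht) //.
- exact: h1.
- by move=> y ym; rewrite -(eq_N ht); apply: h3.
- exact: h4.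
Qed.

Lemma eq_need T U n c : (forall c', c <= c' < c + n -> T c' =1 U c') ->
  need T n c =2 need U n c.
Proof.
elim: n c => [//|n IH] c h; apply: eq_gstep; first by apply: h; lia.
by apply: IH => c' hc'; apply: h; lia.
Qed.

Lemma eq_fit T U n c : (forall c', c <= c' < c + n -> T c' =1 U c') ->
  fit T n c -> fit U n c.
Proof.
elim: n c => [//|n IH] c h [f1 f2]; have h' c' : c.+1 <= c' < c.+1 + n -> T c' =1 U c'.
  by move=> hc'; apply: h; lia.
split; first exact: IH f1.
by apply: eq_fits f2; [apply: h; lia | apply: eq_need].
Qed.

Lemma need_vanish T n c : fit T n c -> vanish B (need T n c).
Proof.
by elim: n c => [//|n IH] c [f1 f2]; apply: gstep_vanish => //; apply: IH.
Qed.

Lemma need_unit T n c : fit T n c -> unit_steps (need T n c).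
Proof.
elim: n c => [//|n IH] c [f1 f2]; apply: gstep_unit; [by case: f2 | | exact: IH].
exact: need_vanish.
Qed.

Lemma need_next T n c y (b : bool) : fit T n c ->
    (forall c', c <= c' -> D c' y.+1 -> b) ->
  forall x, need T n c x y.+1 <= need T n c x y + b.
Proof.
elim: n c => [//|n IH] c [f1 f2] hb; apply: gstep_next_label => //.
- exact: need_vanish.
- exact: hb.
- by apply: IH => // c' hc'; apply: hb; lia.
Qed.

Lemma need_gap T n c p y : fit T n c -> (forall c', c <= c' < c + n -> ~~ T c' p.+1) ->
  need T n c p y <= need T n c p.+1 y.
Proof.
elim: n c => [//|n IH] c [f1 f2] hp; apply: gstep_gap; first by case: f2.
- exact: need_vanish.
- by apply: hp; lia.
- by apply: IH => // c' hc'; apply: hp; lia.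
Qed.

Lemma need_label_growth T n c r : fit T n c -> 0 < r ->
  (forall c', D c' r -> D c' r.+1) -> label_growth r (need T n c).
Proof.
move=> + r0 dr; elim: n c => [|n IH] c; first by left.
by case=> f1 f2; exact: (gstep_label_growth (@hD c) f2 (need_vanish f1) r0 (dr c) (IH _ f1)).
Qed.

(** * Moving one cell in a family of columns *)

Definition moved T (c0 s e : nat) : nat -> nat -> bool :=
  fun c => if c == c0 then mvcell (T c0) s e else T c.

Lemma moved_at T c s e : moved T c s e c = mvcell (T c) s e.
Proof. by rewrite /moved eqxx. Qed.

Lemma moved_ne T c0 s e c : c != c0 -> moved T c0 s e c = T c.
Proof. by rewrite /moved => /negbTE->. Qed.

Lemma need_moved_head T n c s e :
  need (moved T c s e) n.+1 c =2 gstep B (mvcell (T c) s e) (D c) (need T n c.+1).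
Proof.
move=> x y; rewrite -moved_at /=; apply: eq_gstep => //.
by apply: eq_need => c' hc' z; rewrite moved_ne //; lia.
Qed.

Lemma fit_moved_head T n c s e : fit T n c.+1 ->
  fits B (mvcell (T c) s e) (D c) (need T n c.+1) -> fit (moved T c s e) n.+1 c.
Proof.
have eqT c' : c.+1 <= c' < c.+1 + n -> T c' =1 moved T c s e c'.
  by move=> hc' z; rewrite moved_ne //; lia.
move=> f1 f2; split; first exact: eq_fit f1.
by rewrite moved_at; apply: eq_fits f2 => //; apply: eq_need.
Qed.

Lemma fit_moved_up T n c c0 p q : fit T n c -> c <= c0 < c + n ->
    0 < q < p -> T c0 p -> ~~ T c0 q -> (forall i, q < i < p -> T c0 i) ->
    (forall c', c0 < c' < c + n -> ~~ T c' p) ->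
  fit (moved T c0 p q) n c /\
  forall x y, need (moved T c0 p q) n c x y <= need T n c x y.
Proof.
elim: n c => [|n IH] c; first by move=> _; lia.
case=> f1 f2 hc qp Tp Tq Tpq right.
have hv := need_vanish f1; have hu := need_unit f1.
have [e|cc0] := eqVneq c c0.
  subst c0; have [|f2' le] := mvcell_up f2 hv hu qp Tp Tq Tpq _.
    move=> y; have p1 : p = p.-1.+1 by lia.
    rewrite [X in _ <= need _ _ _ X _]p1; apply: need_gap => // c' hc'.
    by rewrite -p1; apply: right; lia.
  by split=> [|x y]; [exact: fit_moved_head | rewrite need_moved_head].
have [||f1' le] := IH c.+1 f1 _ qp Tp Tq Tpq _; first by lia.
  by move=> c' hc'; apply: right; lia.
split=> [|x y /=]; rewrite /= moved_ne //; first by split=> //; apply: fits_le f2.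
by apply: gstep_le => //; [case: f2 | exact: need_vanish].
Qed.

(* The cell in row s of column c0 can be lowered to row e: it comes back by a
   Kohnert move. *)
Definition lowerable T (n c c0 s e : nat) :=
  [/\ c <= c0 < c + n, [&& 0 < s, s < e & e <= B], T c0 s && ~~ T c0 e,
      forall i, s < i < e -> T c0 i & forall c', c0 < c' < c + n -> ~~ T c' e].

Lemma lowerableS T n c c0 s e : lowerable T n c.+1 c0 s e -> lowerable T n.+1 c c0 s e.
Proof. by case=> h1 h2 h3 h4 h5; split=> // [|c' hc']; [lia | apply: h5; lia]. Qed.

Lemma first_gap t rho : bounded B t ->
  exists e, [/\ rho < e, ~~ t e & forall i, rho < i < e -> t i].
Proof.
move=> ht; have ex : exists e, (rho < e) && ~~ t e.
  exists (maxn rho B).+1; rewrite ltnS leq_maxl /=.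
  by apply/negP => /ht; lia.
exists (ex_minn ex); case: ex_minnP => e /andP[re te] hmin; split=> // i /andP[ri ie].
by apply/negPn/negP => ti; have := hmin i; rewrite ri ti => /(_ isT); lia.
Qed.

(** The vanishing hypothesis says that no label up to rho is forced into row rho or below. It is
    inherited by the columns to the right, at rho if this column avoids rho and at the gap e
    otherwise; [slack_growth] is what comes back. *)
Lemma lower_row T n c rho : fit T n c -> 0 < rho ->
    (exists2 c', c <= c' < c + n & T c' rho) -> need T n c rho.-1 rho = 0 ->
  exists c0 s e, [/\ lowerable T n c c0 s e, fit (moved T c0 s e) n c
    & slack_growth rho (need T n c) (need (moved T c0 s e) n c)].
Proof.
elim: n c rho => [|n IH] c rho; first by move=> _ _ [c']; lia.
case=> f1 f2 r0 [c' hc' Tc'] G0; have [ht h2 h3 h4] := f2.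
have hv := need_vanish f1; rewrite /= in G0.
have [Tr|Tr] := boolP (T c rho); last first.
  have ne : c != c' by apply: contraNneq Tr => ->.
  have g0 : need T n c.+1 rho.-1 rho = 0.
    have [rm|mr] := leqP rho (maxrow B (D c)).
      have := h4 rho rho.-1; have := NS (T c) rho.-1.
      by rewrite prednK // (negbTE Tr); lia.
    by have := gstep_high ht hv mr (leqnn rho.-1); lia.
  have [|c0 [s [e [low f1' sl]]]] := IH c.+1 rho f1 r0 _ g0.
    by exists c' => //; lia.
  have cc0 : c != c0 by case: low; lia.
  have [f2' _ sl'] := slack_column f2 hv (need_vanish f1') (need_unit f1) r0 Tr sl.
  by exists c0, s, e; rewrite /= moved_ne //; split=> //; apply: lowerableS.
have [e [re Te Tre]] := first_gap rho ht.
have hy x y : need T n c.+1 x y.+1 <= (need T n c.+1 x y).+1.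
  by have := @need_next T n c.+1 y true f1 (fun _ _ _ => isT) x; rewrite addn1.
have [em f2' sl] := settle_column f2 hv hy Tr G0 Te re Tre.
have eB : e <= B by rewrite (leq_trans em) ?maxrow_leq.
(* If row e is occupied further right, the search restarts there. As e is a gap here, [slack_column]
   applies at e, and the run from rho to [e.-1] carries the slack up to rho. *)
have [/existsP[i Ti]|/existsPn Ti] := boolP [exists i : 'I_n, T (c.+1 + i) e].
  have g0 : need T n c.+1 e.-1 e = 0.
    have := h4 e e.-1; have := NS (T c) e.-1.
    by rewrite prednK ?(negbTE Te); lia.
  have e0 : 0 < e by lia.
  have [|c0 [s [e' [low f1' sl']]]] := IH c.+1 e f1 e0 _ g0.
    by exists (c.+1 + i) => //; have := ltn_ord i; lia.
  have cc0 : c != c0 by case: low; lia.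
  have hv' := need_vanish f1'.
  have [f2'' le sl''] := slack_column f2 hv hv' (need_unit f1) e0 Te sl'.
  exists c0, s, e'; rewrite /= moved_ne //; split=> //; first exact: lowerableS.
  apply: (slack_growth_run (e := e)) => //.
  - exact: gstep_vanish f2'' hv'.
  - exact: ltnW.
  - by move=> j /andP[rj je]; have [->//|?] := eqVneq j rho; apply: Tre; lia.
exists c, rho, e; split; [|exact: fit_moved_head |].
  2: by move=> x y; rewrite need_moved_head; exact: sl.
split=> //; [lia | lia | by rewrite Tr | move=> c'' hc''].
have lt : c'' - c.+1 < n by lia.
by have := Ti (Ordinal lt); rewrite /= subnKC //; lia.
Qed.

(** By the northwest property, a label up to [maxrow B (D c)] in a later column is a label of column
    c, so each step in y raises the need by at most [D c y]. *)
Lemma fits_labels T n c : fit T n c.+1 -> fits B (D c) (D c) (need T n c.+1).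
Proof.
move=> f1; split=> // y z /andP[zy ym].
rewrite -(subnKC zy) in ym *; elim: (y - z) ym => [|k IH] ym.
  by rewrite addn0 (need_vanish f1) // leqnn orbT.
rewrite addnS in ym *; have := IH (ltnW ym); rewrite NS.
have := @need_next T n c.+1 (z + k) (D c (z + k).+1) f1.
by move=> /(_ (fun c' hc' Dc' => nwD hc' Dc' ym) z); lia.
Qed.

Lemma fit_labels n c : fit D n c.
Proof. by elim: n c => [//|n IH] c; split=> //; apply: fits_labels. Qed.

Lemma subset_column t d : (forall i, t i -> d i) -> N t B = N d B ->
  forall i, 0 < i <= B -> t i = d i.
Proof.
move=> td e.
have gap k : N t B + (N d (B - k) - N t (B - k)) <= N d B /\ N t (B - k) <= N d (B - k).
  have le x : N t x <= N d x.
    by elim: x => [//|x IH]; rewrite !NS; have := td x.+1; case: (t _) => [->|]; lia.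
  split=> //; elim: k => [|k IH]; first by rewrite subn0; have := le B; lia.
  have [Bk|kB] := leqP B k; first by rewrite (_ : B - k.+1 = 0) ?N0; have := le B; lia.
  have := le (B - k.+1); move: IH; have -> : B - k = (B - k.+1).+1 by lia.
  by rewrite !NS; have := td (B - k.+1).+1; case: (t _) => [->|]; lia.
move=> i /andP[i0 iB].
have := gap (B - i); have := gap (B - i.-1); rewrite !subKn //; last by lia.
have := NS t i.-1; have := NS d i.-1; rewrite prednK //; have := td i.
by case: (t i) => [->|]; case: (d i) => //=; lia.
Qed.

(** A cell of column c outside D starts the search of [lower_row]. Without one, column c equals that
    of D; it then fits whatever happens on its right, and the induction moves on. *)
Lemma exists_lowerable T n c : fit T n c ->
    (exists c' x, [/\ c <= c' < c + n, 0 < x <= B & T c' x != D c' x]) ->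
  exists c0 s e, lowerable T n c c0 s e /\ fit (moved T c0 s e) n c.
Proof.
elim: n c => [|n IH] c; first by move=> _ [c' [x []]]; lia.
move=> f; have [f1 f2] := f; have [ht h2 h3 h4] := f2.
have hv := need_vanish f1.
have [/existsP[i /andP[Ti Di]] _|/existsPn TD] := boolP [exists i : 'I_B.+1, T c i && ~~ D c i].
  have i0 := ht _ Ti.
  have im : i <= maxrow B (D c).
    have [//|mi] := leqP i (maxrow B (D c)).
    have := @fits_top B (T c) (D c) _ i.-1 f2 ltac:(lia).
    have := @fits_top B (T c) (D c) _ i f2 ltac:(lia).
    by have := NS (T c) i.-1; rewrite prednK ?Ti; lia.
  (* Label i is absent from column c, hence by the northwest property from all later ones, so
     passing from [i.-1] to i costs nothing ([b = false]). *)
  have G0 : need T n.+1 c i.-1 i = 0.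
    have z0 : need T n.+1 c i.-1 i.-1 = 0.
      by apply: (need_vanish f); rewrite leqnn orbT.
    have := @need_next T n.+1 c i.-1 false f; rewrite prednK; last by lia.
    move=> h; have {h} := h _ i.-1; rewrite z0 leqn0 => h; apply/eqP/h => c' hc' Dc'.
    have [e|ne] := eqVneq c c'; first by rewrite e Dc' in Di.
    by rewrite (nwD (c' := c')) // in Di; lia.
  have [||c0 [s [e [low f' _]]]] := lower_row f _ _ G0; first by lia.
    by exists c => //; lia.
  by exists c0, s, e.
have sub j : T c j -> D c j.
  move=> Tj; have := ht _ Tj => jB; have jB' : j < B.+1 by lia.
  by have := TD (Ordinal jB'); rewrite /= Tj negbK.
have eqTD := subset_column sub h2.
case=> c' [x [hc' hx ne]].
have [e|cc'] := eqVneq c' c; first by rewrite e eqTD ?eqxx // in ne.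
have [|c0 [s [e [low f']]]] := IH c.+1 f1; first by exists c', x; split=> //; lia.
have cc0 : c != c0 by case: low; lia.
exists c0, s, e; split; first exact: lowerableS.
split=> //; rewrite moved_ne //.
have eqc : D c =1 T c.
  move=> j; have [jB|jB] := boolP (0 < j <= B); first by rewrite eqTD.
  have -> : T c j = false by apply: contraNF jB; apply: ht.
  by apply: contraNF jB; apply: hD.
by apply: eq_fits (fits_labels f') => //.
Qed.

(* Every cell of row r+1 in the columns from c on is paired within them. *)
Definition balanced T (r c : nat) := forall e,
  \sum_(c <= i < e) T i r.+1 <= \sum_(c <= i < e) T i r.

Lemma balanced_cons T r c : T c r.+1 <= T c r -> balanced T r c.+1 -> balanced T r c.
Proof.
move=> le h e; have [ec|ce] := leqP e c; first by rewrite !big_geq.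
by rewrite !(@big_ltn _ _ _ c) // leq_add.
Qed.

(** [balanced] serves as P. Left of c0, a balanced right side excludes a cell in row r without one
    in row [r.+1], and a column with equal occupancy of both rows keeps the balance. *)
Lemma fit_lowered T n c c0 r : fit T n c -> 0 < r -> (forall c', D c' r -> D c' r.+1) ->
    c <= c0 < c + n -> T c0 r -> ~~ T c0 r.+1 -> balanced T r c0.+1 ->
    (forall c', c' < c0 -> T c' r -> ~~ T c' r.+1 -> ~ balanced T r c'.+1) ->
  fit (moved T c0 r r.+1) n c /\
  jump_growth r (balanced T r c) (need T n c) (need (moved T c0 r r.+1) n c).
Proof.
move=> + r0 dr + Tr Tr1 bal0 left; elim: n c => [|n IH] c; first by move=> _; lia.
case=> f1 f2 hc; have hv := need_vanish f1.
have [e|cc0] := eqVneq c c0.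
  subst c0.
  have [f2' jg] := lower_column (@hD c) f2 hv r0 (dr c) (need_label_growth f1 r0 dr) Tr Tr1.
  split=> [|x y]; first exact: fit_moved_head.
  have [le|[xr l1 l2 l3 _]] := jg x y; first by left; rewrite need_moved_head.
  right; rewrite need_moved_head; split=> //.
  by apply: balanced_cons => //; rewrite (negbTE Tr1).
have [|f1' jg] := IH c.+1 f1; first by lia.
have [|f2' jg'] := jump_growth_column f2 hv (need_vanish f1') r0 _ jg.
  move=> b Tcr; apply/negPn/negP => Tcr1; apply: (left c) => //; lia.
rewrite /= moved_ne //.
split=> // x y; have [le|[xr l1 l2 l3 [b e]]] := jg' x y; [by left | right].
by split=> //; apply: balanced_cons; rewrite // e.
Qed.

End Diagrams.

(** * Pairing and the crystal operators *)

Local Open Scope fset_scope.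

Implicit Types X : {fset cell}.

Definition occ X (c x : nat) : bool := (x, c) \in X.

Lemma mem_row_cols X i a : (a \in row_cols X i) = occ X a i.
Proof.
rewrite /row_cols mem_sort; apply/mapP/idP => [[[j b]]|h].
  by rewrite mem_filter /= => /andP[/eqP-> h] ->.
by exists (i, a) => //; rewrite mem_filter eqxx.
Qed.

Lemma uniq_row_cols X i : uniq (row_cols X i).
Proof.
rewrite sort_uniq map_inj_in_uniq ?filter_uniq ?fset_uniq //.
move=> [j a] [k b]; rewrite !mem_filter /= => /andP[/eqP-> _] /andP[/eqP-> _].
by move=> ->.
Qed.

Lemma sorted_row_cols X i : sorted leq (row_cols X i).
Proof. exact: sort_sorted leq_total _. Qed.

Lemma sum_occ X i c e :
  \sum_(c <= j < e) occ X j i = count (fun a => c <= a < e) (row_cols X i).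
Proof.
rewrite (eq_bigr (fun j => if j \in row_cols X i then 1 else 0)); last first.
  by move=> j _; rewrite mem_row_cols; case: occ.
rewrite -big_mkcond sum1_count -!size_filter; apply/perm_size/uniq_perm.
- exact/filter_uniq/iota_uniq.
- exact/filter_uniq/uniq_row_cols.
- by move=> j; rewrite !mem_filter mem_index_iota /= andbC.
Qed.

Lemma unzip1P (M : seq (nat * nat)) (a : nat) :
  reflect (exists2 p : nat * nat, p \in M & a = p.1) (a \in unzip1 M).
Proof. exact: mapP. Qed.

Lemma unzip2P (M : seq (nat * nat)) (b : nat) :
  reflect (exists2 p : nat * nat, p \in M & b = p.2) (b \in unzip2 M).
Proof. exact: mapP. Qed.

Section Pairing.

Variables (X : {fset cell}) (i : nat).

(** The list carries its history: each pair was admissible when just the pairs after it had been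
    made. *)
Fixpoint pairing_run (M : seq (nat * nat)) : bool :=
  if M is p :: M' then
    [&& can_pair X i M' p, occ X p.1 i, occ X p.2 i.+1 & pairing_run M']
  else true.

Lemma pairing_runP : pairing_run (pairing X i).
Proof.
rewrite /pairing; elim: (size _) => [//|k IH] /=; rewrite /pair_step.
case E: (pairable _ _ _) => [//|p s] /=; rewrite IH andbT.
have : p \in pairable X i (iter k (pair_step X i) [::]) by rewrite E mem_head.
rewrite mem_filter => /andP[-> /allpairsP[[a b]]] [/= + + ->].
by rewrite !mem_row_cols => -> ->.
Qed.

Implicit Types M : seq (nat * nat).

Lemma run_mem M (p : nat * nat) : pairing_run M -> p \in M ->
  [/\ occ X p.1 i, occ X p.2 i.+1 & p.1 <= p.2].
Proof.
elim: M => [//|q M IH] /= /and4P[/and5P[le _ _ _ _] h1 h2 hM].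
by rewrite inE => /predU1P[->|/(IH hM)].
Qed.

Lemma run_uniq M : pairing_run M -> uniq (unzip1 M) && uniq (unzip2 M).
Proof.
elim: M => [//|q M IH] /= /and4P[/and5P[_ h1 h2 _ _] _ _ hM].
by rewrite h1 h2 IH.
Qed.

Lemma run_under1 M (p : nat * nat) a : pairing_run M -> p \in M -> occ X a i ->
  p.1 < a <= p.2 -> a \in unzip1 M.
Proof.
move=> + + ha hp; elim: M => [//|q M IH] /= /and4P[/and5P[_ _ _ h _] _ _ hM].
rewrite !inE => /predU1P[e|/(IH hM)->]; last by rewrite orbT.
by move/allP: h => /(_ a); rewrite mem_row_cols ha -e hp => /(_ isT) /= ->; rewrite orbT.
Qed.

Lemma run_under2 M (p : nat * nat) b : pairing_run M -> p \in M -> occ X b i.+1 ->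
  p.1 <= b < p.2 -> b \in unzip2 M.
Proof.
move=> + + hb hp; elim: M => [//|q M IH] /= /and4P[/and5P[_ _ _ _ h] _ _ hM].
rewrite !inE => /predU1P[e|/(IH hM)->]; last by rewrite orbT.
by move/allP: h => /(_ b); rewrite mem_row_cols hb -e hp => /(_ isT) /= ->; rewrite orbT.
Qed.

(** Of two crossing arcs, the later one would have an end under the earlier one, where every cell
    was already paired. *)
Lemma run_nested M (p q : nat * nat) : pairing_run M -> p \in M -> q \in M ->
  p.1 < q.1 <= p.2 -> q.2 < p.2.
Proof.
elim: M => [//|p0 M IH] /= /and4P[/and5P[_ n1 n2 _ _] o1 o2 hM].
rewrite !inE => /predU1P[->|pM] /predU1P[->|qM] h.
- by lia.
- rewrite ltnNge; apply: contra n2 => le.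
  have [e|ne] := eqVneq p0.2 q.2; first by rewrite e; apply: map_f.
  by apply: (run_under2 hM qM) => //; lia.
- by move: n1; rewrite (run_under1 hM pM).
- exact: IH.
Qed.

Notation M := (pairing X i).

(** Otherwise take such a pair at minimal distance: no unpaired cell lies between, so it would still
    be pairable. *)
Lemma unpaired_lt a b : occ X a i -> a \notin unzip1 M ->
  occ X b i.+1 -> b \notin unzip2 M -> b < a.
Proof.
have [k] := ubnP (b - a); elim: k a b => [//|k IH] a b lt oa na ob nb.
rewrite ltnNge; apply/negP => ab.
have : (a, b) \notin pairable X i M by rewrite pairable_pairing.
rewrite mem_filter negb_and; have -> : (a, b) \in [seq (a, b) | a <- row_cols X i, b <- row_cols X i.+1].
  by apply/allpairsP; exists (a, b); rewrite !mem_row_cols.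
rewrite orbF /can_pair /= ab na nb /= negb_and => /orP[|] /allPn[j].
  rewrite mem_row_cols negb_imply => oj /andP[hj nj].
  by have := IH j b ltac:(lia) oj nj ob nb; lia.
rewrite mem_row_cols negb_imply => oj /andP[hj nj].
by have := IH a j ltac:(lia) oa na oj nj; lia.
Qed.

Lemma uniq_unzip_filter (P : pred (nat * nat)) :
  uniq (unzip1 (filter P M)) /\ uniq (unzip2 (filter P M)).
Proof.
have /andP[u1 u2] := run_uniq pairing_runP.
by split; [apply: subseq_uniq u1 | apply: subseq_uniq u2];
   apply/map_subseq/filter_subseq.
Qed.

(** Every cell of row i in these columns has its partner strictly left of b by nesting, and b itself
    comes in addition. *)
Lemma paired_excess c b : (c, b) \in M -> c < b ->
  \sum_(c.+1 <= j < b.+1) occ X j i < \sum_(c.+1 <= j < b.+1) occ X j i.+1.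
Proof.
move=> cb lt; rewrite !sum_occ -!size_filter.
pose P (p : nat * nat) := c < p.1 <= b.
have [u1 u2] := uniq_unzip_filter P; have run := pairing_runP.
have [_ ob _] := run_mem run cb.
have le1 : size [seq a <- row_cols X i | c.+1 <= a < b.+1] <= size (unzip1 (filter P M)).
  apply: uniq_leq_size => [|a]; first exact/filter_uniq/uniq_row_cols.
  rewrite mem_filter mem_row_cols ltnS => /andP[ha oa].
  have /unzip1P[p pM e] := run_under1 run cb oa ha.
  by rewrite e; apply: map_f; rewrite mem_filter pM andbT /P -e.
have le2 : size (b :: unzip2 (filter P M)) <=
           size [seq a <- row_cols X i.+1 | c.+1 <= a < b.+1].
  have lower (p : nat * nat) : p \in filter P M -> p.2 < b.
    by rewrite mem_filter => /andP[hp pM]; apply: (run_nested run cb).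
  apply: uniq_leq_size => [|a].
    rewrite /= u2 andbT; apply/unzip2P => -[p /lower]; lia.
  rewrite inE mem_filter mem_row_cols => /predU1P[->|/unzip2P[p pM ->]].
    by rewrite ob; lia.
  have := lower p pM; move: pM; rewrite mem_filter => /andP[/andP[h1 h2] pM].
  have [_ -> le] := run_mem run pM; lia.
by move: le1 le2; rewrite /= !size_map; apply: leq_ltn_trans.
Qed.

Lemma balanced_right a :
    (forall b, occ X b i.+1 -> a < b -> exists2 p : nat * nat, p \in M & p.2 = b /\ a < p.1) ->
  balanced (occ X) i a.+1.
Proof.
move=> h e; rewrite !sum_occ -!size_filter.
pose P (p : nat * nat) := (a < p.1) && (p.2 < e).
have [u1 u2] := uniq_unzip_filter P; have run := pairing_runP.
have le2 : size [seq b <- row_cols X i.+1 | a.+1 <= b < e] <= size (unzip2 (filter P M)).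
  apply: uniq_leq_size => [|b]; first exact/filter_uniq/uniq_row_cols.
  rewrite mem_filter mem_row_cols => /andP[/andP[ab be] ob].
  have [p pM [e2 ap]] := h b ob ab.
  by rewrite -e2; apply: map_f; rewrite mem_filter pM /P ap e2 be.
apply: leq_trans le2 _; rewrite size_map -(size_map fst); apply: uniq_leq_size => // b.
case/unzip1P => p; rewrite !mem_filter mem_row_cols => /andP[/andP[h1 h2] pM] ->.
have [-> _ le] := run_mem run pM; lia.
Qed.

(** No arc passes over an unpaired cell, so all cells of row [i.+1] from column a on have partners
    right of a. With [paired_upper_unbalanced], being unpaired becomes a condition on counts. *)
Lemma unpaired_upper_balanced a : occ X a i -> a \notin unzip1 M ->
  ~~ occ X a i.+1 /\ balanced (occ X) i a.+1.
Proof.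
move=> oa na; have run := pairing_runP.
have partner b : occ X b i.+1 -> a <= b -> exists2 p : nat * nat, p \in M & p.2 = b /\ a < p.1.
  move=> ob ab; have : b \in unzip2 M.
    by apply/negPn/negP => nb; have := unpaired_lt oa na ob nb; lia.
  case/unzip2P => p pM e; exists p => //; split=> //.
  have [_ _ le] := run_mem run pM; rewrite ltnNge; apply: contra na => pa.
  have [ep|ne] := eqVneq a p.1; first by rewrite ep; apply: map_f.
  by apply: (run_under1 run pM oa); lia.
split; last by apply: balanced_right => b ob ab; apply: partner; lia.
apply/negP => ob; have [p pM [e ap]] := partner a ob (leqnn a).
by have [_ _ le] := run_mem run pM; lia.
Qed.

Lemma paired_upper_unbalanced a : a \in unzip1 M -> ~~ occ X a i.+1 ->
  ~ balanced (occ X) i a.+1.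
Proof.
case/unzip1P => -[c b] pM /= -> nb; have [_ /= ob cb] := run_mem pairing_runP pM.
have lt : c < b by rewrite ltn_neqAle cb andbT; apply: contraNneq nb => ->.
by move=> /(_ b.+1); rewrite leqNgt paired_excess.
Qed.

End Pairing.

(* Column c carries the leftmost unpaired cell of row i. *)
Definition lowering_column X i c :=
  [/\ occ X c i, ~~ occ X c i.+1, balanced (occ X) i c.+1
    & forall c', c' < c -> occ X c' i -> ~~ occ X c' i.+1 -> ~ balanced (occ X) i c'.+1].

Lemma lower_some X U i : lower i X = Some U ->
  exists2 c, lowering_column X i c & U = move_cell X (i, c) (i.+1, c).
Proof.
rewrite /lower /unpaired_upper; case E: (filter _ _) => [//|c s] /= [<-].
have : c \in [seq a <- row_cols X i | a \notin unzip1 (pairing X i)].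
  by rewrite E mem_head.
rewrite mem_filter mem_row_cols => /andP[nc oc].
have [nc1 bal] := unpaired_upper_balanced oc nc; exists c => //; split=> // c' lt oc' nc'.
apply: paired_upper_unbalanced => //; apply/negPn/negP => nM.
have : sorted leq (c :: s).
  by rewrite -E; apply/sorted_filter/sorted_row_cols; apply: leq_trans.
rewrite /= => /(order_path_min leq_trans)/allP hs.
have : c' \in c :: s by rewrite -E mem_filter mem_row_cols nM.
by rewrite inE => /predU1P[e|/hs]; lia.
Qed.

Lemma lower_of X i c : lowering_column X i c ->
  lower i X = Some (move_cell X (i, c) (i.+1, c)).
Proof.
case=> oc nc bal left.
have nM : c \notin unzip1 (pairing X i).
  by apply/negP => /paired_upper_unbalanced/(_ nc).
case E: (lower i X) => [U|]; last first.
  move: E; rewrite /lower; case E: (unpaired_upper X i) => [|//] _.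
  by have := mem_filter (fun a => a \notin unzip1 (pairing X i)) c (row_cols X i);
     rewrite -/(unpaired_upper X i) E mem_row_cols oc nM.
have [c0 [oc0 nc0 bal0 left0] ->] := lower_some E.
by have [lt|lt|->//] := ltngtP c0 c; [case: (left c0) | case: (left0 c)].
Qed.

Lemma move_cellK X x y : x \in X -> y \notin X -> move_cell (move_cell X x y) y x = X.
Proof.
move=> xX yX; apply/fsetP => z; rewrite !inE.
have [->|zx] := eqVneq z x; first by rewrite xX.
by have [->|zy] /= := eqVneq z y; first by rewrite (negbTE yX).
Qed.

Lemma occ_move X c s e c' : occ (move_cell X (s, c) (e, c)) c' =1 moved (occ X) c s e c'.
Proof.
move=> x; rewrite /occ /moved !inE !xpair_eqE.
by have [->|ne] := eqVneq c' c; rewrite /mvcell ?andbT ?andbF //= andbC.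
Qed.

(** [lowering_column] involves only counts away from b, so it is checked on W through the pairing of
    X. No arc passes over the unpaired b, and all cells of row i left of b are paired. *)
Lemma raiseK X Y i : raise i X = Some Y -> lower i Y = Some X.
Proof.
rewrite /raise; case E: (rev _) => [//|b s] /= [<-].
have run := pairing_runP X i.
have memE b' : (b' \in rev (b :: s)) = (b' \notin unzip2 (pairing X i)) && occ X b' i.+1.
  by rewrite -E revK mem_filter mem_row_cols.
have /andP[nb ob] : (b \notin unzip2 (pairing X i)) && occ X b i.+1.
  by rewrite -memE mem_rev mem_head.
have last b' : occ X b' i.+1 -> b < b' -> b' \in unzip2 (pairing X i).
  move=> ob' lt; apply/negPn/negP => nb'.
  have : sorted geq (b :: s).
    rewrite -E rev_sorted; apply/sorted_filter/sorted_row_cols.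
    by move=> x y z; apply: leq_trans.
  rewrite /= => /(order_path_min (rev_trans leq_trans))/allP hs.
  have : b' \in b :: s by rewrite -mem_rev memE nb' ob'.
  by rewrite inE => /predU1P[e|/hs]; rewrite /=; lia.
have no : ~~ occ X b i.
  apply/negP => oa; have [/unzip1P[p pM e]|na] := boolP (b \in unzip1 (pairing X i)).
    have [_ _ le] := run_mem run pM; move/negP: nb; apply.
    have [e2|ne] := eqVneq b p.2; first by rewrite e2; apply: map_f.
    by apply: (run_under2 run pM ob); lia.
  by have := unpaired_lt oa na ob nb; rewrite ltnn.
set W := move_cell _ _ _.
have oW j x : j != b -> occ W j x = occ X j x.
  by move=> jb; rewrite occ_move moved_ne.
have sumW c e x : (forall j, c <= j < e -> j != b) ->
    \sum_(c <= j < e) occ W j x = \sum_(c <= j < e) occ X j x.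
  by move=> h; apply: eq_big_nat => j hj; rewrite oW ?h.
rewrite (@lower_of W i b); first by rewrite move_cellK.
split.
- by rewrite occ_move moved_at /mvcell eqxx.
- by rewrite occ_move moved_at /mvcell eqxx andbF orbF; lia.
- have bal : balanced (occ X) i b.+1.
    apply: balanced_right => b' ob' lt; have /unzip2P[p pM e] := last b' ob' lt.
    exists p => //; split=> //; rewrite ltnNge; apply: contra nb => pb.
    by apply: (run_under2 run pM ob); lia.
  by move=> e; rewrite !sumW //; move=> j; lia.
- move=> c' lt; rewrite !oW; [|lia|lia] => oc' nc' balW.
  have : c' \in unzip1 (pairing X i).
    by apply/negPn/negP => nM; have := unpaired_lt oc' nM ob nb; lia.
  case/unzip1P => -[c b1] pM /= e; subst c'; have [_ /= ob1 cb1] := run_mem run pM.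
  have cb : c < b1 by rewrite ltn_neqAle cb1 andbT; apply: contraNneq nc' => ->.
  have b1b : b1 < b.
    rewrite ltnNge; apply: contra nb => le.
    have [->|ne] := eqVneq b b1; first by apply/unzip2P; exists (c, b1).
    by apply: (run_under2 run pM ob) => /=; lia.
  have := balW b1.+1; rewrite !sumW; [|by move=> j; lia|by move=> j; lia].
  by rewrite leqNgt paired_excess.
Qed.

(** * Reachability *)

Section Reachability.

Variables (D : {fset cell}) (B n : nat).
Hypothesis hNW : northwest D.
Hypothesis hB : forall x : cell, x \in D -> 0 < x.1 <= B.
Hypothesis hn : forall x : cell, x \in D -> 0 < x.2 < n.

Lemma occ_bounded c : bounded B (occ D c).
Proof. by move=> x /hB. Qed.

Lemma occ_northwest c c' i : c < c' -> occ D c' i -> i <= maxrow B (occ D c) -> occ D c i.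
Proof.
move=> cc' h im; have i0 := hB h; rewrite /= in i0.
have m : occ D c (maxrow B (occ D c)) by apply: maxrow_mem; lia.
have [->//|ne] := eqVneq i (maxrow B (occ D c)).
by apply: (hNW _ cc' m h); lia.
Qed.

Definition in_columns X := forall x : cell, x \in X -> 0 < x.2 < n.

Lemma in_columns_move X s e c : in_columns X -> (s, c) \in X ->
  in_columns (move_cell X (s, c) (e, c)).
Proof. by move=> h hc x; rewrite !inE => /predU1P[->|/andP[_ /h//]]; apply: (h _ hc). Qed.

Lemma fit_bounded T m c : fit B (occ D) T m c ->
  forall c', c <= c' < c + m -> bounded B (T c').
Proof.
elim: m c => [|m IH] c; first by move=> _ c'; lia.
case=> f1 [h _ _ _] c' hc'; have [->//|ne] := eqVneq c' c.
by apply: IH f1 _ _; lia.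
Qed.

Lemma KD_fit X : KD D X -> fit B (occ D) (occ X) n 0 /\ in_columns X.
Proof.
pose I Y := fit B (occ D) (occ Y) n 0 /\ in_columns Y.
have ID : I D.
  by split=> //; apply: fit_labels; [exact: occ_bounded | exact: occ_northwest].
suff step Y Z : kohnert_move Y Z -> I Y -> I Z.
  move=> h; move: h ID; rewrite -/(I X).
  by elim=> [Y Z /step//|//|X1 X2 X3 _ IH1 _ IH2 /IH1/IH2].
case=> p [q [c [[pX right] [qp qX] between ->]]] [f cols].
have cn := cols _ pX; split; last exact: in_columns_move.
have [|||f' _] := @fit_moved_up B (occ D) (occ Y) n 0 c p q f _ qp pX qX _ _.
- by move: cn => /=; lia.
- by move=> i hi; apply: between.
- by move=> c' hc'; apply/negP => /right; lia.
by apply: eq_fit f' => c' _ x; rewrite occ_move.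
Qed.

Lemma fit_KD X : fit B (occ D) (occ X) n 0 -> in_columns X -> KD D X.
Proof.
(* The sum decreases because a lowered cell stays within row B. Induction reaches the lowered
   diagram from D, and one Kohnert move then restores X. *)
have [k] := ubnP (\sum_(x <- X) (B - x.1)); elim: k X => [//|k IH] X lt f cols.
have [->|ne] := eqVneq X D; first exact: rt_refl.
have [c [x [hc hx d]]] : exists c x, [/\ 0 <= c < 0 + n, 0 < x <= B & occ X c x != occ D c x].
  have [x hx] : exists x : cell, (x \in X) != (x \in D).
    have [/fsubsetP XD|/fsubsetPn[x xX xD]] := boolP (X `<=` D); last first.
      by exists x; rewrite xX (negbTE xD).
    have [/fsubsetP DX|/fsubsetPn[x xD xX]] := boolP (D `<=` X); last first.
      by exists x; rewrite xD (negbTE xX).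
    by case/eqP: ne; apply/fsetP => x; apply/idP/idP => [/XD|/DX].
  exists x.2, x.1; rewrite /occ -surjective_pairing; split=> //.
    have [xX|xX] := boolP (x \in X); first by have := cols _ xX; lia.
    by move: hx; rewrite (negbTE xX); case E: (x \in D) => // _; have := hn E; lia.
  have [xX|xX] := boolP (x \in X).
    have := cols _ xX => hc; apply: (@fit_bounded _ _ _ f x.2); first by lia.
    by rewrite /occ -surjective_pairing.
  by move: hx; rewrite (negbTE xX); case E: (x \in D) => // _; apply: hB.
have ex : exists c' x', [/\ 0 <= c' < 0 + n, 0 < x' <= B & occ X c' x' != occ D c' x'].
  by exists c, x.
have [c0 [s [e [[h1 /and3P[s0 se eB] /andP[sX eX] h4 h5] f']]]] :=
  exists_lowerable occ_bounded occ_northwest f ex.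
set U := move_cell X (s, c0) (e, c0).
have fU : fit B (occ D) (occ U) n 0 by apply: eq_fit f' => c' _ i; rewrite occ_move.
have colsU : in_columns U by apply: in_columns_move.
apply: rt_trans (IH U _ fU colsU) _.
  have yX : (e, c0) \notin X `\ (s, c0) by rewrite !inE negb_and eX orbT.
  move: lt; rewrite (big_fsetD1 _ sX) /= /U /move_cell big_fsetU1 //= ltnS.
  by apply: leq_trans; rewrite ltn_add2r; lia.
apply: rt_step; exists e, s, c0; split.
- split=> [|c']; first by rewrite !inE eqxx.
  rewrite !inE => /predU1P[[->//]|/andP[_ hc']]; rewrite leqNgt; apply/negP => lt'.
  have := h5 c'; rewrite /occ hc' => /(_ _)/negP; apply=> //.
  by have := cols _ hc'; rewrite /=; lia.
- split; first by lia.
  by rewrite !inE eqxx /= orbF xpair_eqE eqxx andbT; lia.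
- move=> i hi; have iX : (i, c0) \in X by exact: h4.
  rewrite !inE iX !xpair_eqE eqxx !andbT.
  by apply/orP; right; apply: contraTneq hi => ->; rewrite ltnn.
- by rewrite move_cellK.
Qed.

Lemma KD_lower r X U : 0 < r -> (forall c, (r, c) \in D -> (r.+1, c) \in D) ->
  KD D X -> lower r X = Some U -> KD D U.
Proof.
move=> r0 hrow /KD_fit[f cols] /lower_some[c [oc nc bal left] ->].
apply: fit_KD; last exact: in_columns_move.
have cn := cols _ oc; rewrite /= in cn.
have [||f' _] := @fit_lowered B (occ D) _ (occ X) n 0 c r f r0 hrow _ oc nc bal left.
- exact: occ_bounded.
- by lia.
by apply: eq_fit f' => c' _ x; rewrite occ_move.
Qed.

Lemma KD_is_diagram X : KD D X -> is_diagram X.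
Proof.
case/KD_fit=> f cols [x c] h; have := cols _ h => /= hc.
have := @fit_bounded _ _ _ f c _ x h; lia.
Qed.

End Reachability.

Theorem theorem4p11 (D : {fset cell}) (r : nat)
    (hD : is_diagram D) (hNW : northwest D) (hr : 0 < r)
    (hrow : forall c : nat, (r, c) \in D -> (r.+1, c) \in D) :
  (forall T : {fset cell}, KD D T -> lower r T <> None ->
     exists U : {fset cell}, lower r T = Some U /\ KD D U) /\
  (forall U : {fset cell}, demazure r (KD D) U <-> KD D U).
Proof.
pose B := \max_(x <- D) x.1; pose n := (\max_(x <- D) x.2).+1.
have hB (x : cell) : x \in D -> 0 < x.1 <= B.
  move=> xD; have [-> _] := hD x xD.
  exact: (@leq_bigmax_seq _ (enum_fset D) xpredT (fun x : cell => x.1)).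
have hn (x : cell) : x \in D -> 0 < x.2 < n.
  move=> xD; have [_ ->] := hD x xD; rewrite ltnS.
  exact: (@leq_bigmax_seq _ (enum_fset D) xpredT (fun x : cell => x.2)).
have closed := KD_lower hNW hB hn hr hrow.
split=> [T hT|U].
  by case E: (lower r T) => [U|//] _; exists U; split=> //; apply: closed E.
split=> [[dU [k [V [hk hV]]]]|hU]; last first.
  by split; [exact: (KD_is_diagram hNW hB hn hU) | exists 0, U].
(* The last raising is undone first: [raiseK] turns it into a lowering, under which [KD D] is
   closed. *)
elim: k V hk hV => [V [->]//|k IH V].
rewrite /raise_iter iterS; case E: (iter k _ _) => [W|//] /= hW hV.
by apply: IH E _; apply: closed hV _; apply: raiseK.
Qed.
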